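(* Let $f\colon X\to\overline{\mathbb{R}}$ be a proper function, $x_0\in\operatorname{dom}f$ and $\varepsilon\ge0$. Then $$\partial_c f'_\varepsilon(x_0,\cdot)(0)\cap\big(X^*\times\{(u^*,\alpha)\in X^*\times\mathbb{R}:\langle x_0,u^*\rangle<\alpha\}\big)=\partial_{c,\varepsilon}f(x_0)\cap\big(X^*\times\mathcal{N}(\operatorname{dom}f,x_0)\times\mathbb{R}_{++}\big).$$
   Context: $X$ is a nontrivial separated (Hausdorff) real locally convex space with continuous dual $X^*$; $\langle x,x^*\rangle$ is the value of $x^*\in X^*$ at $x\in X$. $\overline{\mathbb{R}}=\mathbb{R}\cup\{\pm\infty\}$, $\mathbb{R}_{++}=(0,+\infty)$. $W:=X^*\times X^*\times\mathbb{R}$. For an extended-real-valued function $h$, $\operatorname{dom}h=\{h<+\infty\}$; $h$ is proper if it never takes the value $-\infty$ and $\operatorname{dom}h\neq\emptyset$. Coupling function: $c(x,(x^*,u^*,\alpha)):=\langle x,x^*\rangle$ if $\langle x,u^*\rangle<\alpha$, and $+\infty$ otherwise. $\varepsilon$-$c$-subdifferential: for $h\colon X\to\overline{\mathbb{R}}$ with $h(x_0)\in\mathbb{R}$ and $\varepsilon\ge0$, $\partial_{c,\varepsilon}h(x_0)$ is the set of $w=(x^*,u^*,\alpha)\in W$ such that $\langle x_0,u^*\rangle<\alpha$ and $h(x)-h(x_0)\ge c(x,w)-c(x_0,w)-\varepsilon$ for all $x\in X$; $\partial_c h(x_0):=\partial_{c,0}h(x_0)$. The $\varepsilon$-directional derivative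 of $f$ at $x_0$ along $u\in X$ is $f'_\varepsilon(x_0,u):=\inf_{t>0}\frac{f(x_0+tu)-f(x_0)+\varepsilon}{t}$. $\partial_c f'_\varepsilon(x_0,\cdot)(0)$ is the $c$-subdifferential at the point $0\in X$ of the function $u\mapsto f'_\varepsilon(x_0,u)$ (whose value at $0$ is $0$); it is defined by the same inequalities even if this function takes the value $-\infty$ somewhere (in which case it is empty). Normal cone of a set $C\subseteq X$ at $x_0\in C$: $\mathcal{N}(C,x_0)=\{u^*\in X^*:\langle x-x_0,u^*\rangle\le0\text{ for all }x\in C\}$ (this formula is used for $C=\operatorname{dom}f$, which need not be convex). *)

(* Defs.v *)
From HB Require Import structures.
From mathcomp Require Import all_boot all_order all_algebra.
From mathcomp Require Import all_classical all_reals all_analysis.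

Set Implicit Arguments.
Unset Strict Implicit.
Unset Printing Implicit Defensive.

Import Order.TTheory GRing.Theory Num.Theory.
Import numFieldNormedType.Exports.

Local Open Scope classical_set_scope.
Local Open Scope ring_scope.
Local Open Scope ereal_scope.

Record dual (R : realType) (X : tvsType R) : Type := Dual {
  dual_fun : {scalar X} ;
  dual_continuous : continuous (dual_fun : X -> R)
}.

Definition pairing (R : realType) (X : tvsType R) (x : X) (xs : dual X) : R :=
  dual_fun xs x.

Definition edom (R : realType) (X : Type) (h : X -> \bar R) : set X :=
  [set x | h x < +oo].

Definition proper_fun (R : realType) (X : Type) (h : X -> \bar R) : Prop :=
  (forall x, h x != -oo) /\ edom h !=set0.

(* The triple (x*, u*, alpha) is encoded as (x*, (u*, alpha)). *)
Definition W (R : realType) (X : tvsType R) : Type :=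
  (dual X * (dual X * R))%type.

Definition coupling (R : realType) (X : tvsType R) (x : X) (w : W X) : \bar R :=
  let: (xs, (us, a)) := w in
  if (pairing x us < a)%R then (pairing x xs)%:E else +oo.

(* The notion is only meant for real h x0; otherwise the set is empty here.
   Under the first two conditions all the differences below are well defined,
   i.e., no oo - oo occurs, even when h takes the value -oo. *)
Definition c_eps_subdiff (R : realType) (X : tvsType R) (eps : R)
    (h : X -> \bar R) (x0 : X) : set (W X) :=
  [set w | [/\ h x0 \is a fin_num,
               (pairing x0 w.2.1 < w.2.2)%R &
               forall x, h x - h x0 >=
                 coupling x w - coupling x0 w - eps%:E]].

Definition c_subdiff (R : realType) (X : tvsType R)
    (h : X -> \bar R) (x0 : X) : set (W X) :=
  c_eps_subdiff 0%R h x0.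

Definition eps_dirder (R : realType) (X : tvsType R) (eps : R)
    (f : X -> \bar R) (x0 u : X) : \bar R :=
  ereal_inf [set (f (x0 + t *: u)%R - f x0 + eps%:E) / t%:E
            | t in [set t : R | (0 < t)%R]].

Definition normal_cone (R : realType) (X : tvsType R) (C : set X) (x0 : X) :
    set (dual X) :=
  [set us | forall x, C x -> (pairing (x - x0)%R us <= 0)%R].

(* Main.v *)
(** An inequality [y <= inf_t ...] is the family of inequalities over [t], so
    each subdifferential is described by conditions on the finite values of [f]
    only.  The coupling takes the value [+oo] where [a <= <u, us>]; hence for a
    [c]-subgradient [(xs, us, a)] at [0] of the directional derivative, every
    positive multiple of [u := x - x0], [x] in the domain of [f], lies in the
    half-space [<u, us> < a].  As the multiples are unbounded, this gives
    [<u, us> <= 0], the normal cone condition. *)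

Require Import Defs.
From HB Require Import structures.
From mathcomp Require Import all_boot all_order all_algebra.
From mathcomp Require Import all_classical all_reals all_analysis.
From mathcomp Require Import lra.

Import Order.TTheory GRing.Theory Num.Theory.
Import numFieldNormedType.Exports.

Local Open Scope classical_set_scope.
Local Open Scope ring_scope.

Section Pairing.
Context {R : realType} {X : tvsType R}.
Implicit Types (x y : X) (xs : dual X).

Lemma pairing0 xs : pairing 0 xs = 0.
Proof. exact: linear0. Qed.

Lemma pairingD x y xs : pairing (x + y) xs = pairing x xs + pairing y xs.
Proof. exact: linearD. Qed.

Lemma pairingB x y xs : pairing (x - y) xs = pairing x xs - pairing y xs.
Proof. exact: linearB. Qed.

Lemma pairingZ (t : R) x xs : pairing (t *: x) xs = t * pairing x xs.
Proof. exact: scalarZ. Qed.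

End Pairing.

Lemma fin_num_cases {R : realType} (y : \bar R) :
  y != -oo%E -> y = +oo%E \/ exists r, y = r%:E.
Proof. by case: y => [r| |] // _; [right; exists r | left]. Qed.

Section Characterizations.
Context {R : realType} {X : tvsType R}.
Implicit Types (f h : X -> \bar R) (x u : X) (w : W X) (eps : R).

Lemma coupling_fin {x w} : pairing x w.2.1 < w.2.2 ->
  coupling x w = (pairing x w.1)%:E.
Proof. by case: w => xs [us a] /= ->. Qed.

Lemma coupling_pinfty {x w} : w.2.2 <= pairing x w.2.1 ->
  coupling x w = +oo%E.
Proof. by case: w => xs [us a] /=; rewrite leNgt => /negbTE ->. Qed.

(** Where [h] is [+oo] the inequality is trivial. At a finite value it fails as soon as the coupling
    is [+oo], which forces the point into the open half-space. *)
Lemma c_eps_subdiffP {eps h x0} {h0 : R} w :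
  (forall x, h x != -oo%E) -> h x0 = h0%:E ->
  c_eps_subdiff eps h x0 w <->
  pairing x0 w.2.1 < w.2.2 /\
  forall x r, h x = r%:E ->
    pairing x w.2.1 < w.2.2 /\ pairing (x - x0) w.1 <= r - h0 + eps.
Proof.
move=> hNy hx0; split.
  move=> [_ w0 hw]; split=> // x r hx; have := hw x.
  rewrite hx hx0 (coupling_fin w0).
  have [xw|xw] := ltP (pairing x w.2.1) w.2.2.
    rewrite (coupling_fin xw) -!EFinB lee_fin pairingB => le_hx.
    by split=> //; lra.
  by rewrite (coupling_pinfty xw).
move=> [w0 hw]; split=> [|//|x]; first by rewrite hx0.
rewrite hx0 (coupling_fin w0).
have [->|[r hx]] := fin_num_cases _ (hNy x).
  by rewrite leey.
have [xw le_hx] := hw _ _ hx.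
rewrite hx (coupling_fin xw) -!EFinB lee_fin.
by move: le_hx; rewrite pairingB => le_hx; lra.
Qed.

(** At [u = 0] every quotient is [eps / t]: nonnegative, and arbitrarily small for large [t]. *)
Lemma eps_dirder0 {eps f x0} : f x0 \is a fin_num -> 0 <= eps ->
  eps_dirder eps f x0 0 = 0%E.
Proof.
move=> /fineK fx0 eps0; apply/eqP; rewrite eq_le; apply/andP; split.
  apply/lee_addgt0Pr => e e0; rewrite add0e.
  (* For this [t] the quotient is [e * eps / (eps + 1) <= e]; the [+ 1] keeps [t] positive when
     [eps = 0]. *)
  have t0 : 0 < (eps + 1) / e by rewrite divr_gt0 // ltr_wpDl.
  apply: le_trans (ereal_inf_lbound _) _; first by exists ((eps + 1) / e).
  rewrite scaler0 addr0 -fx0 -EFinB subrr add0e inver gt_eqF // -EFinM lee_fin.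
  by rewrite ler_pdivrMr // mulrC divfK ?gt_eqF //; lra.
apply: le_ereal_inf_tmp => _ [t t0 <-].
rewrite scaler0 addr0 -fx0 -EFinB subrr add0e inver gt_eqF // -EFinM lee_fin.
by rewrite divr_ge0 // ltW.
Qed.

(** The bound [y] is extended real so that it can be a coupling value, possibly [+oo]. *)
Lemma le_eps_dirder {eps f x0 u} {f0 : R} (y : \bar R) :
  (forall x, f x != -oo%E) -> f x0 = f0%:E ->
  (y <= eps_dirder eps f x0 u)%E <->
  forall t r, 0 < t -> f (x0 + t *: u) = r%:E ->
    (y <= ((r - f0 + eps) / t)%:E)%E.
Proof.
move=> fNy fx0; split.
  move=> ley t r t0 ft; apply: (le_trans ley); apply: ereal_inf_lbound.
  by exists t => //; rewrite ft fx0 inver gt_eqF.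
move=> ley; apply: le_ereal_inf_tmp => _ [t t0 <-].
have [ft|[r ft]] := fin_num_cases _ (fNy (x0 + t *: u)).
  rewrite ft fx0 inver gt_eqF // !addye //.
  by rewrite gt0_mulye ?leey // lte_fin invr_gt0.
by rewrite ft fx0 inver gt_eqF // -!EFinB -EFinD -EFinM ley.
Qed.

(** The directional derivative may take the value [-oo], so [c_eps_subdiffP] does not apply to it;
    the infimum is unfolded instead. *)
Lemma c_subdiff_dirderP {eps f x0} {f0 : R} w :
  (forall x, f x != -oo%E) -> f x0 = f0%:E -> 0 <= eps ->
  c_subdiff (eps_dirder eps f x0) 0 w <->
  0 < w.2.2 /\
  forall u t r, 0 < t -> f (x0 + t *: u) = r%:E ->
    pairing u w.2.1 < w.2.2 /\ t * pairing u w.1 <= r - f0 + eps.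
Proof.
move=> fNy fx0 eps0.
have d0 : eps_dirder eps f x0 0 = 0%E by rewrite eps_dirder0 // fx0.
have couplingE u : 0 < w.2.2 ->
    (coupling u w - coupling 0%R w - 0%:E = coupling u w)%E.
  by move=> a0; rewrite (@coupling_fin 0) ?pairing0 // !sube0.
split.
  move=> [_]; rewrite pairing0 => a0 dw; split=> // u t r t0 ft.
  have := dw u; rewrite d0 couplingE // sube0 => /(le_eps_dirder _ fNy fx0).
  move=> /(_ _ _ t0 ft).
  have [uw|uw] := ltP (pairing u w.2.1) w.2.2.
    by rewrite (coupling_fin uw) lee_fin ler_pdivlMr // mulrC.
  by rewrite (coupling_pinfty uw).
move=> [a0 fw]; split=> [||u]; rewrite ?d0 ?pairing0 //.
rewrite couplingE // sube0; apply/(le_eps_dirder _ fNy fx0) => t r t0 ft.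
have [uw le_ft] := fw _ _ _ t0 ft.
by rewrite (coupling_fin uw) lee_fin ler_pdivlMr // mulrC.
Qed.

End Characterizations.

Theorem theorem4p4 (R : realType) (X : tvsType R)
    (X_hausdorff : hausdorff_space X) (X_nontrivial : exists x : X, x != 0)
    (f : X -> \bar R) (f_proper : proper_fun f)
    (x0 : X) (x0_dom : edom f x0) (eps : R) (eps_ge0 : 0 <= eps) :
  c_subdiff (eps_dirder eps f x0) 0
    `&` ([set: dual X] `*` [set ua : dual X * R | pairing x0 ua.1 < ua.2])
  = c_eps_subdiff eps f x0
    `&` ([set: dual X] `*` (normal_cone (edom f) x0 `*` [set a : R | 0 < a])).
Proof.
have [fNy _] := f_proper.
have fin_dom x : edom f x -> exists r, f x = r%:E.
  rewrite /edom /=; have [->|//] := fin_num_cases _ (fNy x).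
  by rewrite ltxx.
have [f0 fx0] := fin_dom _ x0_dom.
apply/seteqP; split=> w.
  move=> [/(c_subdiff_dirderP _ fNy fx0 eps_ge0)[a0 dw] [_ /= w0]].
  have cone : normal_cone (edom f) x0 w.2.1.
    move=> x /fin_dom[r fx]; rewrite leNgt; apply/negP => p0.
    set p := pairing (x - x0) w.2.1 in p0.
    (* The multiple of [x - x0] on the boundary hyperplane [<u, us> = a]. *)
    have t0 : 0 < p / w.2.2 by rewrite divr_gt0.
    have [] := dw ((p / w.2.2)^-1 *: (x - x0)) (p / w.2.2) r t0.
      by rewrite scalerA mulfV ?gt_eqF // scale1r addrC subrK.
    by rewrite pairingZ -/p invf_div divfK ?gt_eqF // ltxx.
  split=> //; apply/(c_eps_subdiffP _ fNy fx0); split=> // x r fx.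
  have dom_x : edom f x by rewrite /edom /= fx ltry.
  (* The cone gives [<x, us> <= <x0, us>], and [<x0, us> < a] by [w0]. *)
  split; first by have := cone _ dom_x; rewrite pairingB => le0; lra.
  (* At [t = 1] the bound along [x - x0] is the [eps]-subgradient inequality at [x]. *)
  have [] := dw (x - x0) 1 r ltr01; first by rewrite scale1r addrC subrK.
  by rewrite mul1r.
move=> [/(c_eps_subdiffP _ fNy fx0)[w0 fw] [_ [cone /= a0]]].
split=> //; apply/(c_subdiff_dirderP _ fNy fx0 eps_ge0); split=> // u t r t0 fx.
have xBx0 : x0 + t *: u - x0 = t *: u by rewrite addrC addKr.
have dom_x : edom f (x0 + t *: u) by rewrite /edom /= fx ltry.
(* Both facts are taken at [x0 + t *: u]; dividing the cone inequality by [t > 0] leaves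
   [<u, us> <= 0 < a]. *)
have [_] := fw _ _ fx; have := cone _ dom_x.
rewrite xBx0 !pairingZ pmulr_rle0 // => u0 le_fx; split=> //.
exact: le_lt_trans u0 a0.
Qed.
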